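(* Let $S\subseteq V(K)$ be an ERR:LD set for the infinite king grid $K$. Then the average share of the vertices in $S$ is at most $\frac{38}{15}$.
   Context: The infinite king grid $K$ has vertex set $\mathbb{Z}^2$, with distinct vertices $(a,b),(c,d)$ adjacent iff $\max(|a-c|,|b-d|)=1$. $N(v)$ is the open neighborhood of $v$ and $N[v]=N(v)\cup\{v\}$. A set $S\subseteq V(K)$ is an ERR:LD (error-correcting locating-dominating) set iff (i) for all $v\in V(K)$, $|N[v]\cap S|\ge 3$; (ii) for all distinct $u,v\in S$, $|((N(v)\cap S)\triangle(N(u)\cap S))\setminus\{v,u\}|\ge 1$; (iii) for all $v\in V(K)\setminus S$ and $u\in S$, $|((N(v)\cap S)\triangle(N(u)\cap S))\setminus\{u\}|\ge 2$; (iv) for all distinct $u,v\in V(K)\setminus S$, $|(N(v)\cap S)\triangle(N(u)\cap S)|\ge 3$. For $v\in V(K)$, $dom(v)=|N[v]\cap S|$; the share of a detector $x\in S$ is $sh(x)=\sum_{u\in N[x]}\frac{1}{dom(u)}$. The average share of the vertices in $S$ is $\limsup_{n\to\infty}\frac{1}{|S\cap Q_n|}\sum_{x\in S\cap Q_n} sh(x)$, where $Q_n=\{-n,\dots,n\}^2$; it equals the reciprocal of the density of $S$. *)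

(* Defs.v *)
From HB Require Import structures.
From mathcomp Require Import all_boot all_order all_algebra.
From mathcomp Require Import finmap.
From mathcomp Require Import all_classical all_reals all_analysis.
From mathcomp Require Import zify.

Set Implicit Arguments.
Unset Strict Implicit.
Unset Printing Implicit Defensive.

Import Order.TTheory GRing.Theory Num.Theory.

Local Open Scope classical_set_scope.
Local Open Scope ring_scope.

Definition vertex : Type := (int * int)%type.

Definition adj (u v : vertex) : Prop :=
  u <> v /\ Num.max `|u.1 - v.1| `|u.2 - v.2| = 1.

Definition nbhd_open (v : vertex) : set vertex := [set u | adj v u].

Definition nbhd_closed (v : vertex) : set vertex := nbhd_open v `|` [set v].

(* [fset_set] is the empty finite set on infinite arguments; [card] is only
   applied to subsets of neighborhoods and of boxes, which are finite by
   [finite_nbhd_closed] and [finite_box] below. *)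
Definition card (A : set vertex) : nat := #|` fset_set A|.

Record err_ld (S : set vertex) : Prop := ErrLD {
  err_ld_dom : forall v : vertex, (3 <= card (nbhd_closed v `&` S))%N ;
  err_ld_in_in : forall u v : vertex, S u -> S v -> u <> v ->
    (1 <= card (((nbhd_open v `&` S) `+` (nbhd_open u `&` S)) `\` [set v; u]))%N ;
  err_ld_out_in : forall v u : vertex, ~ S v -> S u ->
    (2 <= card (((nbhd_open v `&` S) `+` (nbhd_open u `&` S)) `\` [set u]))%N ;
  err_ld_out_out : forall u v : vertex, ~ S u -> ~ S v -> u <> v ->
    (3 <= card ((nbhd_open v `&` S) `+` (nbhd_open u `&` S)))%N
}.

Definition dom (S : set vertex) (v : vertex) : nat := card (nbhd_closed v `&` S).

Definition share (R : realType) (S : set vertex) (x : vertex) : R :=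
  \sum_(u \in nbhd_closed x) (((dom S u)%:R)^-1 : R).

Definition box (n : nat) : set vertex :=
  [set v | - n%:Z <= v.1 <= n%:Z /\ - n%:Z <= v.2 <= n%:Z].

(* When [S `&` box n] is empty the quotient is 0; if [err_ld S] holds this can
   happen only for n = 0, so it does not affect the limit superior. *)
Definition share_mean (R : realType) (S : set vertex) (n : nat) : R :=
  ((card (S `&` box n))%:R)^-1 * \sum_(x \in S `&` box n) share R S x.

Definition average_share (R : realType) (S : set vertex) : \bar R :=
  limn_esup (fun n => (share_mean R S n)%:E).

Lemma finite_int_itv (a b : int) : finite_set [set x : int | a <= x <= b].
Proof.
apply: (sub_finite_set _ (finite_image (fun k : nat => a + k%:Z)
  (finite_II `|b - a|.+1))) => x /= /andP[ax xb].
by exists `|x - a|%N => /=; lia.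
Qed.

Lemma finite_box n : finite_set (box n).
Proof.
exact: (finite_setX (finite_int_itv (- n%:Z) n) (finite_int_itv (- n%:Z) n)).
Qed.

Lemma finite_nbhd_closed v : finite_set (nbhd_closed v).
Proof.
apply: (sub_finite_set _ (finite_setX (finite_int_itv (v.1 - 1) (v.1 + 1))
  (finite_int_itv (v.2 - 1) (v.2 + 1)))) => u /= [[_]|->]; split => /=; lia.
Qed.

(* Main.v *)
From Stdlib Require Import NArith.
Require Import Defs.
From mathcomp Require Import all_boot all_order all_algebra.
From mathcomp Require Import finmap.
From mathcomp Require Import all_classical all_reals all_analysis.
From mathcomp Require Import zify lra.

(** The shares of the detectors in a box add up to the number of vertices of the box,
    up to a boundary term, so the claim is that [S] has lower density at least 15/38.
    Let every vertex [u] split one unit among the detectors of its closed neighborhood,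
    not evenly but in proportion to weights: 3 for an orthogonal and 4 for a diagonal
    neighbor if [u] is not a detector; 11 for [u] itself, 15 for an orthogonal and 10
    for a diagonal neighbor if it is one.  With these weights, unlike with the even
    split that defines the share, every single detector receives at most 38/15, so no
    discharging is needed.  What a detector receives depends on the 5x5 window around
    it, and the windows are checked exhaustively: bounding the contributions of the
    three rows of neighbors separately suffices unless the middle three rows of the
    window are exceptional.  The four axioms enter only through the fact that [S]
    meets at least three times every closed neighborhood and, for [u <> v], the set
    consisting of [u], [v] and the other vertices adjacent to exactly one of them. *)

Set Implicit Arguments.
Unset Strict Implicit.
Unset Printing Implicit Defensive.

Import Order.TTheory GRing.Theory Num.Theory numFieldNormedType.Exports.

Local Open Scope classical_set_scope.
Local Open Scope ring_scope.

(** * Neighborhoods and separators as lists *)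

Definition int_range (n : nat) : seq int := [seq k%:Z - n%:Z | k <- iota 0 n.*2.+1].

Definition box_seq (n : nat) : seq vertex :=
  [seq (i, j) | i <- int_range n, j <- int_range n].

Definition offsets : seq vertex := box_seq 1.

Definition closed_nb (u : vertex) : seq vertex := [seq u + d | d <- offsets].

Definition closed_nbs (A : seq vertex) : seq vertex :=
  flatten [seq closed_nb u | u <- A].

Definition distinguishers (u v : vertex) : seq vertex :=
  [seq z <- closed_nb u ++ closed_nb v |
    (z \notin [:: u; v]) && ((z \in closed_nb u) (+) (z \in closed_nb v))].

Definition separator (u v : vertex) : seq vertex := u :: v :: distinguishers u v.

Lemma mem_int_range n (z : int) : (z \in int_range n) = (`|z| <= n%:Z).
Proof.
apply/mapP/idP => [[k + ->]|hz]; first by rewrite mem_iota; lia.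
by exists (absz (z + n%:Z)); rewrite ?mem_iota; lia.
Qed.

Lemma nth_int_range n k : (k < n.*2.+1)%N -> nth 0 (int_range n) k = k%:Z - n%:Z.
Proof. by move=> kn; rewrite (nth_map 0%N) ?size_iota// nth_iota. Qed.

Lemma mem_box_seq n (u : vertex) :
  (u \in box_seq n) = (`|u.1| <= n%:Z) && (`|u.2| <= n%:Z).
Proof.
case: u => i j; rewrite -!mem_int_range; apply/allpairsP/andP.
  by move=> [[a b] [ia jb [-> ->]]].
by move=> [ir jr]; exists (i, j).
Qed.

Lemma uniq_box_seq n : uniq (box_seq n).
Proof.
have uniq_range : uniq (int_range n) by rewrite map_inj_uniq ?iota_uniq// => a b; lia.
by apply: allpairs_uniq => // -[a b] [c d].
Qed.

Lemma size_box_seq n : size (box_seq n) = (n.*2.+1 ^ 2)%N.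
Proof. by rewrite size_allpairs !size_map size_iota mulnn. Qed.

Lemma mem_translate (t z : vertex) (l : seq vertex) :
  (t + z \in [seq t + w | w <- l]) = (z \in l).
Proof. by apply: mem_map; apply: addrI. Qed.

Lemma mem_closed_nb (u z : vertex) :
  (z \in closed_nb u) = (`|z.1 - u.1| <= 1) && (`|z.2 - u.2| <= 1).
Proof. by rewrite -[in LHS](subrKC u z) mem_translate mem_box_seq. Qed.

Lemma closed_nb_sym (u z : vertex) : (z \in closed_nb u) = (u \in closed_nb z).
Proof. by rewrite !mem_closed_nb (distrC z.1) (distrC z.2). Qed.

Lemma uniq_closed_nb u : uniq (closed_nb u).
Proof. by rewrite map_inj_uniq ?uniq_box_seq//; apply: addrI. Qed.

Lemma closed_nb0 : closed_nb 0 = offsets.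
Proof. by []. Qed.

Lemma closed_nbD t u : closed_nb (t + u) = [seq t + z | z <- closed_nb u].
Proof. by rewrite -map_comp; apply: eq_map => d /=; rewrite addrA. Qed.

Lemma mem_distinguishers (u v z : vertex) : (z \in distinguishers u v) =
  [&& z != u, z != v & (z \in closed_nb u) (+) (z \in closed_nb v)].
Proof.
rewrite mem_filter mem_cat in_cons mem_seq1 negb_or -!andbA.
by case: (z \in closed_nb u); case: (z \in closed_nb v).
Qed.

Lemma distinguishersD t u v :
  distinguishers (t + u) (t + v) = [seq t + z | z <- distinguishers u v].
Proof.
rewrite /distinguishers -[[:: t + u; t + v]]/[seq t + w | w <- [:: u; v]] !closed_nbD.
rewrite -map_cat filter_map; apply: congr1; apply: eq_filter => z.
by rewrite /preim simpl_predE !mem_translate.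
Qed.

Lemma separatorD t u v : separator (t + u) (t + v) = [seq t + z | z <- separator u v].
Proof. by rewrite /separator distinguishersD. Qed.

Lemma separator_subset u v : {subset separator u v <= closed_nb u ++ closed_nb v}.
Proof.
have mem_self w : w \in closed_nb w by rewrite mem_closed_nb !subrr.
move=> z; rewrite 2!inE mem_filter => /or3P[/eqP->|/eqP->|/andP[]//];
  by rewrite mem_cat mem_self ?orbT.
Qed.

(** * Sets met three times *)

Definition shift (t : vertex) (s : pred vertex) : pred vertex := fun z => s (t + z).

Definition meets_thrice (T : Type) (s : pred T) (l : seq T) : bool := (3 <= count s l)%N.

(* The four axioms together say that [S] meets each of these sets at least thrice. *)
Definition triple_sets (A : seq vertex) : seq (seq vertex) :=
  [seq closed_nb u | u <- A] ++
  [seq separator u v | u <- A, v <- [seq v <- A | v != u]].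

Definition admissible (s : pred vertex) (A : seq vertex) : bool :=
  all (meets_thrice s) (triple_sets A).

Lemma admissibleP (s : pred vertex) (A : seq vertex) :
  reflect ({in A, forall u, meets_thrice s (closed_nb u)} /\
           {in A &, forall u v, u != v -> meets_thrice s (separator u v)})
          (admissible s A).
Proof.
rewrite /admissible all_cat; apply: (iffP andP) => -[nbs seps]; split.
- by move=> u uA; apply: (allP nbs); apply: map_f.
- move=> u v uA vA uv; apply: (allP seps); apply/allpairsPdep; exists u, v.
  by rewrite mem_filter vA eq_sym uv.
- by apply/allP => _ /mapP[u uA ->]; apply: nbs.
- apply/allP => _ /allpairsPdep[u [v [uA + ->]]]; rewrite mem_filter => /andP[vu vA].
  by apply: seps; rewrite // eq_sym.
Qed.

Lemma admissible_subset (s : pred vertex) (A B : seq vertex) :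
  {subset A <= B} -> admissible s B -> admissible s A.
Proof.
move=> AB /admissibleP[nbs seps]; apply/admissibleP; split => [u /AB|u v /AB uB /AB vB].
  exact: nbs.
exact: seps.
Qed.

Lemma eq_in_meets_thrice (T : eqType) (s s' : pred T) (l : seq T) :
  {in l, s =1 s'} -> meets_thrice s l = meets_thrice s' l.
Proof. by move=> ss'; rewrite /meets_thrice (eq_in_count ss'). Qed.

Lemma eq_in_admissible (s s' : pred vertex) (A : seq vertex) :
  {in closed_nbs A, s =1 s'} -> admissible s A = admissible s' A.
Proof.
move=> ss'.
have ss'_nb u : u \in A -> {in closed_nb u, s =1 s'}.
  by move=> uA z zu; apply: ss'; apply/flatten_mapP; exists u.
suff ss'_sets : {in triple_sets A, forall l, {in l, s =1 s'}}.
  by apply: eq_in_all => l /ss'_sets/eq_in_meets_thrice.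
move=> l; rewrite mem_cat => /orP[/mapP[u uA ->]|]; first exact: ss'_nb.
move=> /allpairsPdep[u [v [uA + ->]]]; rewrite mem_filter => /andP[_ vA] z.
by move=> /separator_subset; rewrite mem_cat => /orP[]; apply: ss'_nb.
Qed.

Lemma meets_thriceD (s : pred vertex) t l :
  meets_thrice s [seq t + z | z <- l] = meets_thrice (shift t s) l.
Proof. by rewrite /meets_thrice count_map. Qed.

Lemma admissibleD (s : pred vertex) t A :
  admissible s [seq t + u | u <- A] = admissible (shift t s) A.
Proof.
apply/admissibleP/admissibleP => -[nbs seps]; split.
- by move=> u uA; rewrite -meets_thriceD -closed_nbD; apply: nbs; apply: map_f.
- move=> u v uA vA uv; rewrite -meets_thriceD -separatorD.
  by apply: seps; rewrite ?map_f// (inj_eq (addrI t)).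
- by move=> _ /mapP[u uA ->]; rewrite closed_nbD meets_thriceD; apply: nbs.
- move=> _ _ /mapP[u uA ->] /mapP[v vA ->]; rewrite (inj_eq (addrI t)) => uv.
  by rewrite separatorD meets_thriceD; apply: seps.
Qed.

(** * Weighted shares *)

(* The weights come from a numerical search; [b] tells whether the vertex that gives
   is a detector. *)
Definition weight (b : bool) (d : vertex) : nat :=
  nth 0%N (if b then [:: 11; 15; 10] else [:: 0; 3; 4])%N (`|d.1| + `|d.2|).

Definition total_weight (s : pred vertex) (u : vertex) : nat :=
  sumn [seq weight (s u) d | d <- offsets & s (u + d)].

Definition ceil_div (a b : N) : N := ((a + N.pred b) / b)%num.

(* Amounts are rounded up to integers; [max_wshare] is [38/15] of the unit. *)
Definition unit_wshare : N := 1200.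
Definition max_wshare : N := 3040.

Definition wshare (s : pred vertex) (u z : vertex) : N :=
  ceil_div (unit_wshare * N.of_nat (weight (s u) (z - u))) (N.of_nat (total_weight s u)).

Definition received (s : pred vertex) (A : seq vertex) (z : vertex) : N :=
  foldr N.add 0%num [seq wshare s u z | u <- A].

Lemma leq_ceil_div (a : N) (b : nat) : (0 < b)%N ->
  (N.to_nat a <= b * N.to_nat (ceil_div a (N.of_nat b)))%N.
Proof.
rewrite /ceil_div => b0; set c := (_ + _)%num.
have := N.div_mod c (N.of_nat b); have := N.mod_lt c (N.of_nat b).
by rewrite /c; nia.
Qed.

Lemma weight_gt0 (b : bool) d : d \in offsets -> ((d == 0) ==> b) -> (0 < weight b d)%N.
Proof. by move=> dO; apply/implyP; move: d dO; apply/allP; case: b. Qed.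

Lemma total_weightE (s : pred vertex) u :
  total_weight s u = (\sum_(z <- closed_nb u | s z) weight (s u) (z - u)%R)%N.
Proof.
rewrite /total_weight sumnE big_map big_filter big_map.
by apply: eq_bigr => d _; rewrite addrC addKr.
Qed.

Lemma total_weight_gt0 (s : pred vertex) u :
  has s (closed_nb u) -> (0 < total_weight s u)%N.
Proof.
rewrite total_weightE => /hasP[z zu sz]; rewrite (big_rem z)//= sz addn_gt0.
apply/orP; left; apply: weight_gt0; last by rewrite subr_eq0; apply/implyP => /eqP<-.
by move: zu; rewrite mem_closed_nb mem_box_seq.
Qed.

Lemma sum_wshare_ge (s : pred vertex) u : has s (closed_nb u) ->
  (N.to_nat unit_wshare <= \sum_(z <- closed_nb u | s z) N.to_nat (wshare s u z))%N.
Proof.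
move=> /total_weight_gt0 total_gt0; rewrite -(leq_pmul2l total_gt0).
rewrite {1}total_weightE big_distrl big_distrr.
apply: leq_sum => z _; apply: leq_trans (leq_ceil_div _ total_gt0).
by rewrite Nnat.N2Nat.inj_mul Nnat.Nat2N.id; apply: eq_leq; apply: mulnC.
Qed.

Lemma wshareD (s : pred vertex) t u z :
  wshare s (t + u) (t + z) = wshare (shift t s) u z.
Proof.
rewrite /wshare [t + z]addrC addrKA /total_weight.
by under eq_filter do rewrite -addrA.
Qed.

Lemma eq_in_wshare (s s' : pred vertex) u z :
  {in closed_nb u, s =1 s'} -> wshare s u z = wshare s' u z.
Proof.
move=> ss'; rewrite /wshare /total_weight ss' ?mem_closed_nb ?subrr//.
congr (ceil_div _ (N.of_nat (sumn (map _ _)))); apply: eq_in_filter => d dO.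
by apply: ss'; apply: map_f.
Qed.

Lemma eq_in_received (s s' : pred vertex) (A : seq vertex) z :
  {in closed_nbs A, s =1 s'} -> received s A z = received s' A z.
Proof.
move=> ss'; congr foldr; apply/eq_in_map => u uA; apply: eq_in_wshare => p pu.
by apply: ss'; apply/flatten_mapP; exists u.
Qed.

Lemma received_cat (s : pred vertex) (A B : seq vertex) z :
  received s (A ++ B) z = (received s A z + received s B z)%num.
Proof.
by elim: A => //= u A ih; rewrite /received /= -/(received _ _ _) ih N.add_assoc.
Qed.

Lemma received_closed_nbD (s : pred vertex) t u :
  received s (closed_nb (t + u)) (t + u) =
  received (shift t s) (closed_nb u) u.
Proof.
rewrite closed_nbD /received -map_comp; congr foldr; apply: eq_map => z.
exact: wshareD.
Qed.

Lemma to_nat_received (s : pred vertex) (A : seq vertex) z :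
  N.to_nat (received s A z) = (\sum_(u <- A) N.to_nat (wshare s u z))%N.
Proof.
rewrite /received; elim: A => [|u A ih]; first by rewrite big_nil.
by rewrite big_cons -ih /= Nnat.N2Nat.inj_add.
Qed.

(** * The window check *)

(* A window lists the rows -2 to 2 of the 5x5 box around the origin; outer rows that
   are unknown are omitted or left blank. *)
Definition window : Type := seq bitseq.

Definition cell (p : vertex) : nat * nat := (absz (p.1 + 2%:Z), absz (p.2 + 2%:Z)).

Definition detector_cell (w : window) (c : nat * nat) : bool :=
  nth false (nth [::] w c.1) c.2.

Definition detector_at (w : window) (p : vertex) : bool := detector_cell w (cell p).

Definition row (i : int) : seq vertex := [seq (i, j) | j <- int_range 1].

(* Sets are converted to row and column numbers once and for all, for speed. *)
Definition cell_tests (A : seq vertex) : seq (seq (nat * nat)) :=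
  [seq map cell l | l <- triple_sets A].

Definition upper_tests : seq (seq (nat * nat)) := cell_tests (row (-1)).
Definition middle_tests : seq (seq (nat * nat)) := cell_tests (row 0).
Definition lower_tests : seq (seq (nat * nat)) := cell_tests (row 1).
Definition window_tests : seq (seq (nat * nat)) := cell_tests offsets.

Definition passes (w : window) (tests : seq (seq (nat * nat))) : bool :=
  all (meets_thrice (detector_cell w)) tests.

Definition bitseqs (n : nat) : seq bitseq :=
  iter n (fun l => [seq b :: r | b <- [:: false; true], r <- l]) [:: [::]].

Definition rows : seq bitseq := bitseqs 5.

(* [fill r] completes the row [r] to the part of the window that determines what the
   neighbors in row [i] give. *)
Definition candidates (i : int) (tests : seq (seq (nat * nat)))
    (fill : bitseq -> window) : seq (bitseq * N) :=
  [seq (r, received (detector_at (fill r)) (row i) 0)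
    | r <- rows & passes (fill r) tests].

Definition upper_candidates (b c : bitseq) : seq (bitseq * N) :=
  candidates (-1) upper_tests (fun a => [:: a; b; c]).

Definition lower_candidates (c d : bitseq) : seq (bitseq * N) :=
  candidates 1 lower_tests (fun e => [:: [::]; [::]; c; d; e]).

Definition max_amount (l : seq (bitseq * N)) : N := foldr N.max 0%num [seq t.2 | t <- l].

(* Conditionals rather than boolean connectives, whose arguments [vm_compute] would
   all evaluate. *)
Definition check_middle (b c d : bitseq) (upper lower : seq (bitseq * N) * N) : bool :=
  if passes [:: [::]; b; c; d] middle_tests then
    let m := received (detector_at [:: [::]; b; c; d]) (row 0) 0 in
    if (upper.2 + (m + lower.2) <=? max_wshare)%num then true
    else all (fun t => all (fun t' =>
      if (t.2 + (m + t'.2) <=? max_wshare)%num then true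
      else ~~ passes [:: t.1; b; c; d; t'.1] window_tests) lower.1) upper.1
  else true.

Definition with_max (l : seq (bitseq * N)) : seq (bitseq * N) * N := (l, max_amount l).

Definition check_center (c : bitseq) : bool :=
  let uppers := [seq (b, with_max (upper_candidates b c)) | b <- rows] in
  let lowers := [seq (d, with_max (lower_candidates c d)) | d <- rows] in
  all (fun t => all (fun t' => check_middle t.1 c t'.1 t.2 t'.2) lowers) uppers.

Definition check : bool := all check_center [seq c <- rows | nth false c 2].

Lemma check_true : check.
Proof. vm_cast_no_check (erefl true). Qed.

Lemma mem_bitseqs n (r : bitseq) : (r \in bitseqs n) = (size r == n).
Proof.
elim: n r => [|n ih] r; first by case: r.
rewrite /bitseqs iterS -/(bitseqs n); apply/allpairsP/idP => [[[b r'] /= [_ + ->]]|].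
  by rewrite ih.
by case: r => //= b r; rewrite eqSS -ih => rn; exists (b, r); split => //; case: b.
Qed.

Lemma passesE w A : passes w (cell_tests A) = admissible (detector_at w) A.
Proof.
by rewrite /passes all_map; apply: eq_all => l; rewrite /meets_thrice /= count_map.
Qed.

Lemma le_max_amount (l : seq (bitseq * N)) t : t \in l -> (t.2 <= max_amount l)%num.
Proof.
rewrite /max_amount; elim: l => //= t' l ih; rewrite inE => /orP[/eqP<-|/ih]; lia.
Qed.

Lemma check_middleP b c d upper lower a ra e re :
  check_middle b c d (with_max upper) (with_max lower) ->
  (a, ra) \in upper -> (e, re) \in lower ->
  passes [:: [::]; b; c; d] middle_tests -> passes [:: a; b; c; d; e] window_tests ->
  (ra + (received (detector_at [:: [::]; b; c; d]) (row 0) 0%R + re) <= max_wshare)%num.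
Proof.
rewrite /check_middle => + a_up e_low mid_ok w_ok; rewrite mid_ok.
case: N.leb_spec => [max_le _|_ /allP/(_ _ a_up)/allP/(_ _ e_low)].
  apply: N.le_trans max_le; apply: N.add_le_mono; first exact: le_max_amount a_up.
  by apply: N.add_le_mono; [exact: N.le_refl|exact: le_max_amount e_low].
by case: N.leb_spec => //; rewrite w_ok.
Qed.

Lemma offsets_rows : offsets = row (-1) ++ row 0 ++ row 1.
Proof. by []. Qed.

Lemma row_subset_offsets (i : int) : `|i| <= 1 -> {subset row i <= offsets}.
Proof. by move=> i1 _ /mapP[j j1 ->]; rewrite mem_box_seq /= i1 -mem_int_range. Qed.

Lemma mem_closed_nbs_row (i : int) z :
  z \in closed_nbs (row i) -> `|z.1 - i| <= 1.
Proof. by move=> /flatten_mapP[_ /mapP[j _ ->]]; rewrite mem_closed_nb => /andP[]. Qed.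

Lemma eq_detector_row (w w' : window) (i : int) : -1 <= i ->
  (forall k : nat, `|k%:Z - 2%:Z - i| <= 1 -> nth [::] w k = nth [::] w' k) ->
  {in closed_nbs (row i), detector_at w =1 detector_at w'}.
Proof.
move=> i1 ww' [x y] /mem_closed_nbs_row /= xi.
by rewrite /detector_at /detector_cell ww'//=; lia.
Qed.

Lemma admissible_row (s : pred vertex) (i : int) : `|i| <= 1 ->
  admissible s offsets -> admissible s (row i).
Proof. by move=> /row_subset_offsets; apply: admissible_subset. Qed.

Lemma mem_candidates (w : window) (i : int) (fill : bitseq -> window) r :
  `|i| <= 1 -> r \in rows -> admissible (detector_at w) offsets ->
  {in closed_nbs (row i), detector_at w =1 detector_at (fill r)} ->
  (r, received (detector_at w) (row i) 0) \in candidates i (cell_tests (row i)) fill.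
Proof.
move=> i1 rR w_adm fillE; apply/mapP; exists r; last by rewrite (eq_in_received _ fillE).
by rewrite mem_filter rR passesE -(eq_in_admissible fillE) admissible_row.
Qed.

Lemma window_received_le a b c d e (w := [:: a; b; c; d; e] : window) :
  {subset w <= rows} -> nth false c 2 -> admissible (detector_at w) offsets ->
  (received (detector_at w) offsets 0%R <= max_wshare)%num.
Proof.
move=> w_rows c2 w_adm.
have [aR bR cR dR eR] : [/\ a \in rows, b \in rows, c \in rows, d \in rows & e \in rows].
  by split; apply: w_rows; rewrite !inE eqxx ?orbT.
have a_cand : (a, received (detector_at w) (row (-1)) 0) \in upper_candidates b c.
  by apply: mem_candidates => //; apply: eq_detector_row => // -[|[|[|k]]]//; lia.
have e_cand : (e, received (detector_at w) (row 1) 0) \in lower_candidates c d.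
  by apply: mem_candidates => //; apply: eq_detector_row => // -[|[|k]]//; lia.
have middleE :
    {in closed_nbs (row 0), detector_at w =1 detector_at [:: [::]; b; c; d]}.
  by apply: eq_detector_row => // -[|[|[|[|k]]]]//; lia.
have := check_true => /allP/(_ c); rewrite mem_filter c2 cR => /(_ isT).
move=> /allP/(_ _ (map_f _ bR))/allP/(_ _ (map_f _ dR))/check_middleP.
move=> /(_ _ _ _ _ a_cand e_cand).
rewrite !passesE -(eq_in_admissible middleE) -(eq_in_received _ middleE).
by rewrite offsets_rows !received_cat; apply; rewrite ?admissible_row.
Qed.

Definition view (s : pred vertex) : window :=
  [seq [seq s (i, j) | j <- int_range 2] | i <- int_range 2].

Lemma detector_at_view (s : pred vertex) : {in box_seq 2, detector_at (view s) =1 s}.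
Proof.
move=> [i j]; rewrite mem_box_seq => /andP[/= i2 j2].
have size_range : size (int_range 2) = 5%N by rewrite size_map size_iota.
have absz_lt5 (k : int) : `|k| <= 2%:Z -> (absz (k + 2%:Z)%R < 5)%N by lia.
have nth_absz (k : int) : `|k| <= 2%:Z -> nth 0 (int_range 2) (absz (k + 2%:Z)) = k.
  by move=> k2; rewrite nth_int_range ?absz_lt5//; lia.
rewrite /detector_at /detector_cell /view (nth_map 0) ?size_range ?absz_lt5//.
by rewrite (nth_map 0) ?size_range ?absz_lt5// !nth_absz.
Qed.

Lemma closed_nbs_offsets_subset : {subset closed_nbs offsets <= box_seq 2}.
Proof. move=> z /flatten_mapP[u]; rewrite mem_closed_nb !mem_box_seq; lia. Qed.

Lemma received_le (s : pred vertex) x : admissible s (closed_nb x) -> s x ->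
  (received s (closed_nb x) x <= max_wshare)%num.
Proof.
rewrite admissibleD; set s' := shift x s => s'_adm sx.
have s'0 : s' 0 by rewrite /s' /shift addr0.
have -> : received s (closed_nb x) x = received s' offsets 0.
  by rewrite -closed_nb0 -received_closed_nbD addr0.
have view_s' : {in closed_nbs offsets, detector_at (view s') =1 s'}.
  by move=> z /closed_nbs_offsets_subset/detector_at_view.
rewrite -(eq_in_received _ view_s').
apply: window_received_le; rewrite ?(eq_in_admissible view_s')//.
by apply/allP; rewrite /= !mem_bitseqs.
Qed.

(** * The axioms as a counting condition *)

Lemma card_le_count (A S : set vertex) (l : seq vertex) :
  A `<=` [set` l] `&` S -> (Defs.card A <= count [in S] l)%N.
Proof.
move=> Al; have finA : finite_set A by apply: sub_finite_set (finite_seq l) => z /Al[].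
rewrite -size_filter /Defs.card (leq_trans _ (size_undup _))// -card_fseq.
apply/fsubset_leq_card/fsubsetP => z; rewrite in_fset_set// inE => /Al[zl Sz].
by rewrite inE mem_filter zl andbT inE.
Qed.

Lemma card_eq_count (S : set vertex) (l : seq vertex) : uniq l ->
  Defs.card ([set` l] `&` S) = count [in S] l.
Proof.
move=> ul; rewrite -size_filter /Defs.card -(undup_id (filter_uniq _ ul)) -card_fseq.
congr #|` _|; rewrite -[RHS]set_fsetK; congr fset_set; apply/seteqP.
split=> z /=; rewrite inE mem_filter /=; first by move=> [-> /mem_set->].
by move=> /andP[/set_mem Sz ->].
Qed.

Lemma adjP (u z : vertex) : adj u z <-> z != u /\ z \in closed_nb u.
Proof.
rewrite mem_closed_nb; case: u z => a b [c d]; rewrite /adj xpair_eqE /=; split.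
  by move=> [/eqP]; rewrite xpair_eqE; lia.
by move=> [zu nb]; split; [apply/eqP; rewrite xpair_eqE|]; lia.
Qed.

Lemma nbhd_closedE (u : vertex) : nbhd_closed u = [set` closed_nb u].
Proof.
apply/seteqP; split=> z /=.
  by move=> [/adjP[]//|->]; rewrite mem_closed_nb !subrr.
by move=> zu; have [->|z_neq_u] := eqVneq z u; [right|left; apply/adjP].
Qed.

Lemma domE (S : set vertex) u : dom S u = count [in S] (closed_nb u).
Proof. by rewrite /dom nbhd_closedE card_eq_count ?uniq_closed_nb. Qed.

Lemma symdiff_distinguishers (S : set vertex) (u v z : vertex) : z <> u -> z <> v ->
  ((nbhd_open v `&` S) `+` (nbhd_open u `&` S)) z -> z \in distinguishers u v /\ S z.
Proof.
move=> /eqP zu /eqP zv.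
have nbhd_openE w : z != w -> nbhd_open w z = (z \in closed_nb w) :> Prop.
  by move=> zw; apply/propext; split=> [/adjP[]//|zw']; apply/adjP.
rewrite /setY /setD /setI /= !nbhd_openE//.
rewrite mem_distinguishers zu zv => -[] [[zN Sz] not_both]; split=> //; rewrite zN ?addbT;
  by apply/negP => zN'; apply: not_both.
Qed.

Section ErrLD.
Variable S : set vertex.
Hypothesis err_ldS : err_ld S.

Lemma meets_thrice_closed_nb u : meets_thrice [in S] (closed_nb u).
Proof. by rewrite /meets_thrice -domE; exact: err_ld_dom. Qed.

Lemma meets_thrice_separator u v : u <> v -> meets_thrice [in S] (separator u v).
Proof.
move=> uv; rewrite /meets_thrice /=.
set D := (nbhd_open v `&` S) `+` (nbhd_open u `&` S).
have DS z : D z -> S z by move=> [] [[]].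
have neq_out w z : ~ S w -> D z -> z <> w by move=> Sw /DS Sz zw; apply: Sw; rewrite -zw.
have card_le A : A `<=` D -> (forall z, A z -> z <> u /\ z <> v) ->
    (Defs.card A <= count [in S] (distinguishers u v))%N.
  move=> AD A_uv; apply: card_le_count => z Az.
  by have [zu zv] := A_uv z Az; apply: symdiff_distinguishers (AD z Az).
have [uS|uS] := boolP (u \in S); have [vS|vS] := boolP (v \in S);
  rewrite ?add1n ?add0n ?ltnS; move: (uS) (vS); rewrite ?notin_setE ?inE => Su Sv.
- apply: leq_trans (err_ld_in_in err_ldS Su Sv uv) (card_le _ (@subDsetl _ _ _) _).
  by move=> z [_ z_uv]; split=> ?; apply: z_uv; [right|left].
- apply: leq_trans (err_ld_out_in err_ldS Sv Su) (card_le _ (@subDsetl _ _ _) _).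
  by move=> z [/neq_out-/(_ _ Sv) zv zu]; split.
- have := err_ld_out_in err_ldS Su Sv; rewrite setYC.
  move=> /leq_trans; apply; apply: (card_le _ (@subDsetl _ _ _)).
  by move=> z [/neq_out-/(_ _ Su) zu zv]; split.
- apply: leq_trans (err_ld_out_out err_ldS Su Sv uv) (card_le _ (fun=> id) _).
  by move=> z Dz; split; apply: neq_out Dz.
Qed.

Lemma err_ld_admissible (A : seq vertex) : admissible [in S] A.
Proof.
apply/admissibleP; split => [u _|u v _ _ /eqP uv]; first exact: meets_thrice_closed_nb.
exact: meets_thrice_separator.
Qed.

End ErrLD.

(** * Double counting *)

Lemma exchange_big_nb (V : Type) (idx : V) (op : Monoid.com_law idx) (T : eqType)
    (nb : T -> seq T) (A B : seq T) (F : T -> T -> V) :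
  (forall u, uniq (nb u)) -> (forall u z, (z \in nb u) = (u \in nb z)) ->
  uniq A -> uniq B -> {in A, forall u, {subset nb u <= B}} ->
  \big[op/idx]_(u <- A) \big[op/idx]_(z <- nb u) F u z =
  \big[op/idx]_(z <- B) \big[op/idx]_(u <- nb z | u \in A) F u z.
Proof.
move=> nb_uniq nb_sym uA uB nbAB.
have big_mem_swap (C D : seq T) (G : T -> V) : uniq C -> uniq D ->
    \big[op/idx]_(z <- C | z \in D) G z = \big[op/idx]_(z <- D | z \in C) G z.
  move=> uC uD; rewrite -big_filter -[RHS]big_filter; apply: perm_big.
  by apply: uniq_perm => [||z]; rewrite ?filter_uniq// !mem_filter andbC.
transitivity (\big[op/idx]_(u <- A) \big[op/idx]_(z <- B | z \in nb u) F u z).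
  apply: eq_big_seq => u /nbAB nbB; rewrite -big_mem_swap//.
  rewrite [LHS]big_seq [RHS]big_seq_cond.
  by apply: eq_bigl => z; case: (boolP (z \in nb u)) => // /nbB ->.
rewrite (exchange_big_dep predT)//=; apply: eq_bigr => z _.
by under eq_bigl do rewrite nb_sym; rewrite big_mem_swap.
Qed.

Lemma closed_nb_subset_box n u : u \in box_seq n -> {subset closed_nb u <= box_seq n.+1}.
Proof. by rewrite mem_box_seq => un z; rewrite mem_closed_nb mem_box_seq; lia. Qed.

Lemma boxE n : box n = [set` box_seq n].
Proof.
rewrite predeqE => u; rewrite /= mem_box_seq !ler_norml.
by split=> [[-> ->]|/andP[]].
Qed.

Lemma shareE (R : realType) (S : set vertex) x :
  share R S x = \sum_(u <- closed_nb x) ((dom S u)%:R)^-1.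
Proof. by rewrite /share nbhd_closedE -fsbig_seq ?uniq_closed_nb. Qed.

(* The box [n.+2] has sides [1 + 4 / (2n + 1)] times those of the box [n]. *)
Definition share_bound (R : realType) (n : nat) : R :=
  38%:R / 15%:R * (1 + 4 * harmonic n) ^+ 2.

Section Counting.
Variable S : set vertex.
Hypothesis err_ldS : err_ld S.

Lemma dom_gt0 u : (0 < dom S u)%N.
Proof. exact: leq_trans (err_ld_dom err_ldS u). Qed.

Lemma received_wshares_le x : x \in S ->
  (\sum_(u <- closed_nb x) N.to_nat (wshare [in S] u x) <= N.to_nat max_wshare)%N.
Proof.
move=> xS; rewrite -to_nat_received.
have := received_le (err_ld_admissible err_ldS (closed_nb x)) xS; lia.
Qed.

Lemma detector_density_ge n :
  (15 * size (box_seq n) <= 38 * count [in S] (box_seq n.+1))%N.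
Proof.
suff : (N.to_nat unit_wshare * size (box_seq n) <=
        N.to_nat max_wshare * count [in S] (box_seq n.+1))%N.
  by rewrite /unit_wshare /max_wshare; lia.
pose passed u z := if z \in S then N.to_nat (wshare [in S] u z) else 0%N.
apply: (@leq_trans (\sum_(u <- box_seq n) \sum_(z <- closed_nb u) passed u z)).
  rewrite -sum1_size big_distrr /=; apply: leq_sum => u _; rewrite muln1 -big_mkcond.
  by apply: sum_wshare_ge; rewrite has_count -domE dom_gt0.
rewrite (exchange_big_nb _ _ uniq_closed_nb closed_nb_sym (uniq_box_seq n)
  (uniq_box_seq n.+1) (@closed_nb_subset_box n)).
rewrite -sum1_count big_distrr [leqRHS]big_mkcond /=; apply: leq_sum => z _.
rewrite muln1 /passed; case: ifP => [zS|_]; last by rewrite big1.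
apply: leq_trans (received_wshares_le zS).
by rewrite [leqRHS](bigID (mem (box_seq n))) leq_addr.
Qed.

Lemma sum_share_le (R : realType) n :
  \sum_(x \in S `&` box n) share R S x <= (size (box_seq n.+1))%:R.
Proof.
set D := [seq x <- box_seq n | x \in S].
have -> : S `&` box n = [set` D].
  rewrite boxE predeqE => x; rewrite /= mem_filter.
  by split=> [[/mem_set-> ->]|/andP[/set_mem]].
rewrite -fsbig_seq ?filter_uniq ?uniq_box_seq//; under eq_bigr do rewrite shareE.
rewrite (exchange_big_nb _ _ uniq_closed_nb closed_nb_sym _ (uniq_box_seq n.+1)).
- rewrite -sum1_size natr_sum; apply: ler_sum => u _.
  rewrite -big_filter big_const_seq count_predT iter_addr_0 size_filter.
  rewrite -[_ *+ count _ _]mulr_natl.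
  rewrite ler_pdivrMr ?ltr0n ?dom_gt0// mul1r ler_nat domE; apply: sub_count => x.
  by rewrite mem_filter => /andP[].
- by rewrite filter_uniq ?uniq_box_seq.
- by move=> x; rewrite mem_filter => /andP[_ /closed_nb_subset_box].
Qed.

Lemma share_mean_le (R : realType) n : share_mean R S n.+1 <= share_bound R n.
Proof.
rewrite /share_mean boxE setIC card_eq_count ?uniq_box_seq//; set c := count _ _.
have size_box k : (size (box_seq k))%:R = (2 * k%:R + 1) ^+ 2 :> R.
  by rewrite size_box_seq natrX -addn1 -muln2 natrD natrM mulrC.
have c_ge : 15 * (2 * n%:R + 1) ^+ 2 <= 38 * c%:R :> R.
  by rewrite -size_box -!natrM ler_nat; exact: detector_density_ge.
have n0 : 0 <= n%:R :> R by exact: ler0n.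
have c_gt0 : 0 < c%:R :> R.
  have : 1 <= (2 * n%:R + 1) ^+ 2 :> R by rewrite exprn_ege1//; lra.
  lra.
have ratio : 2 * n.+2%:R + 1 <= (2 * n%:R + 1) * (1 + 4 * harmonic n) :> R.
  have : 1 <= (2 * n%:R + 1) * harmonic n :> R.
    by rewrite ler_pdivlMr ?ltr0n// -natr1; lra.
  by rewrite -[n.+2]addn2 natrD; lra.
rewrite ler_pdivrMl// -boxE setIC; apply: le_trans (sum_share_le R n.+1) _.
rewrite size_box; apply: (@le_trans _ _ (((2 * n%:R + 1) * (1 + 4 * harmonic n)) ^+ 2)).
  by rewrite ler_pXn2r// nnegrE ?(le_trans _ ratio)// ?addr_ge0 ?mulr_ge0.
by rewrite exprMn /share_bound [leRHS]mulrA ler_wpM2r ?sqr_ge0//; lra.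
Qed.

End Counting.

(** * Passing to the limit *)

Lemma limf_esup_le_near (T : choiceType) (X : filteredType T) (R : realType)
    (u : X -> \bar R) (F : set_system X) (x : \bar R) :
  (\near F, (u F <= x)%E) -> (limf_esup u F <= x)%E.
Proof.
rewrite limf_esupE; set A := [set t | (u t <= x)%E] => FA.
apply: (@le_trans _ _ (ereal_sup [set u t | t in A])).
  by apply: ereal_inf_lbound; exists A.
by apply: ge_ereal_sup => _ [t ut <-].
Qed.

Lemma cvg_share_bound (R : realType) :
  share_bound R n @[n --> \oo] --> (38%:R / 15%:R : R).
Proof.
have ratio_cvg : 1 + 4 * harmonic n @[n --> \oo] --> (1 : R).
  have := cvgD (cvg_cst (1 : R)) (cvgM (cvg_cst (4 : R)) (@cvg_harmonic R)).
  by rewrite mulr0 addr0; apply.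
have := cvgM (cvg_cst (38%:R / 15%:R : R)) (cvgM ratio_cvg ratio_cvg).
by rewrite !mulr1; apply.
Qed.

Theorem theorem5 (R : realType) (S : set vertex) (hS : err_ld S) :
  (average_share R S <= ((38%:R / 15%:R)%R : R)%:E)%E.
Proof.
apply/lee_addgt0Pr => e e0; apply: limf_esup_le_near; apply: near_inftyS; near=> n.
rewrite -EFinD lee_fin; apply: le_trans (share_mean_le hS R n) _.
by near: n; apply: (cvgr_le _ (@cvg_share_bound R)); rewrite ltrDl.
Unshelve. all: by end_near.
Qed.
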